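(* Let $K$ be a totally real number field and $\mathcal O^+$ the set of totally positive algebraic integers of $K$. Let $k\ge2$ and $1\le i\le k$ be integers. Then for all $\delta\in\mathcal O^+$, the partitions $\lambda=(\lambda_1,\ldots,\lambda_r)$ of $\delta$ such that (1) for each part $\lambda_a$ of $\lambda$ there are at most $k-1$ indices $j$ (counting $j=a$) such that $t(\lambda_j)=t(\lambda_a)$ and $s(\lambda_a)-s(\lambda_j)\in\{0,1\}$, and (2) for each primitive element $\gamma$ there are at most $i-1$ indices $j$ such that $\lambda_j=\gamma$, are equinumerous with the partitions of $\delta$ all of whose parts have scale not congruent to $0,i,-i$ modulo $2k+1$.
   Context: A partition of $\delta\in\mathcal O^+$ is a finite sequence $\lambda=(\lambda_1,\ldots,\lambda_r)$ of elements of $\mathcal O^+$ (the parts) with $\lambda_1+\cdots+\lambda_r=\delta$; partitions are considered (and counted) up to change of order, i.e. as multisets. Each $\delta\in\mathcal O^+$ has only finitely many partitions. An element $\gamma\in\mathcal O^+$ is primitive if $\gamma\notin n\mathcal O^+$ for every rational integer $n\ge 2$. Every $\delta\in\mathcal O^+$ can be written uniquely as $\delta=s(\delta)t(\delta)$ with $s(\delta)\in\mathbb Z^+$ (the scale) and $t(\delta)$ primitive (the primitive factor). *)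

(* Defs.v *)
From mathcomp Require Import all_boot all_order all_algebra all_field.
From mathcomp Require Import finmap multiset.
From mathcomp Require Import boolp classical_sets functions cardinality.

Set Implicit Arguments.
Unset Strict Implicit.
Unset Printing Implicit Defensive.

Import Order.TTheory GRing.Theory Num.Theory.

Local Open Scope mset_scope.
Local Open Scope ring_scope.
Local Open Scope classical_set_scope.

Section TotallyRealFields.

(* A number field is a finite extension of rat. Its complex embeddings take
   algebraic values, hence are the ring morphisms into algC. *)
Variable K : fieldExtType rat.
Implicit Types (x g d : K) (l : {mset K}).

Definition totally_real : Prop :=
  forall (sigma : {rmorphism K -> algC}) x, sigma x \is Num.real.

(* In algC, 0 < z says that z is a positive real number. *)
Definition totally_positive x : Prop :=
  forall sigma : {rmorphism K -> algC}, 0 < sigma x.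

Definition algebraic_integer x : Prop :=
  integralOver (intr : int -> K) x.

Definition Oplus : set K :=
  [set x | algebraic_integer x /\ totally_positive x].

Definition primitive g : Prop :=
  Oplus g /\ forall n : nat, (2 <= n)%N -> ~ [set b *+ n | b in Oplus] g.

(* The pair (s(d), t(d)), which exists and is unique for d in Oplus; outside
   Oplus the default (0, 0) is returned. *)
Definition scale_primitive_factor d : nat * K :=
  xget (0%N, 0) [set st : nat * K |
    [/\ (0 < st.1)%N, primitive st.2 & d = st.2 *+ st.1]].

Definition scale d : nat := (scale_primitive_factor d).1.

Definition primitive_factor d : K := (scale_primitive_factor d).2.

(* Partitions up to reordering are finite multisets. The coercion of l to a
   sequence lists every part as often as its multiplicity l x, so that count
   and the sum below range over the indices of the partition. *)
Definition is_partition d l : Prop :=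
  (forall x, x \in l -> Oplus x) /\ \sum_(x <- l) x = d.

Definition gordon_difference_condition (k : nat) l : Prop :=
  forall x, x \in l ->
    (count (fun y => (primitive_factor y == primitive_factor x) &&
                     ((scale x)%:Z - (scale y)%:Z \in [:: 0; 1])%R) l
     <= k - 1)%N.

Definition gordon_primitive_condition (i : nat) l : Prop :=
  forall g, primitive g -> (count (fun y => y == g) l <= i - 1)%N.

Definition gordon_congruence_condition (k i : nat) l : Prop :=
  forall x, x \in l ->
    [/\ ((scale x)%:Z != 0 %[mod (2 * k + 1)%N%:Z])%Z,
        ((scale x)%:Z != i%:Z %[mod (2 * k + 1)%N%:Z])%Z
      & ((scale x)%:Z != - i%:Z %[mod (2 * k + 1)%N%:Z])%Z].

End TotallyRealFields.

(* Main.v *)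
(** Grouping the parts of a partition by primitive factor [g] and dividing by [g]
turns a partition of [delta] into a family of ordinary integer partitions, and both
conditions are conditions on each member of the family.  So it is enough to transport
a weight-preserving bijection between the two classes of integer partitions, i.e. to
prove Gordon's theorem.

For Gordon's theorem let [F_i(m)] be the generating function of the multiplicity
sequences of parts in [m+1..N] with [f_(m+1) < i] and [f_j + f_(j+1) < k].  Sorting by
[f_(m+1)] gives [F_(i+1)(m) = F_i(m) + q^((m+1)i) F_(k-i)(m+1)].  Modulo [q^(N+1)] the
same recurrence, with the boundary value [(q)_N] at [m = N], is satisfied by
[S_i(m) = sum_n (-1)^n q^(kmn + (2k+1)n(n+1)/2 - in) (1 - q^((m+2n+1)i)) (q^(n+1);q)_m],
which is Andrews' solution of the q-difference equations at [z = q^m] multiplied by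
[(q)_N]; this specialization makes every term a polynomial.  At [m = 0] the Jacobi
triple product identity, obtained from the q-binomial theorem, turns [S_i(0)] into the
product of the [1 - q^r] over [r = 0, i, -i mod 2k+1]. *)
Require Import Defs.
From HB Require Import structures.
From mathcomp Require Import all_boot all_order all_algebra all_field.
From mathcomp Require Import finmap multiset.
From mathcomp Require Import boolp classical_sets functions cardinality.
From mathcomp Require Import zify ring.

Set Implicit Arguments.
Unset Strict Implicit.
Unset Printing Implicit Defensive.

Import Order.TTheory GRing.Theory Num.Theory.

Local Open Scope ring_scope.

(** * Polynomials modulo a power of the indeterminate *)

(** Power series are replaced by truncated polynomials; with an explicit quotient [r], compatibility
    with sums and products is a ring identity. *)
Definition eqmodX (N : nat) (p q : {poly int}) := exists r, p = q + r * 'X^N.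

Lemma eqmodX_refl N p : eqmodX N p p.
Proof. by exists 0; rewrite mul0r addr0. Qed.

Lemma eqmodX_sym N p q : eqmodX N p q -> eqmodX N q p.
Proof. by case=> r ->; exists (- r); rewrite mulNr addrK. Qed.

Lemma eqmodX_trans N q p r : eqmodX N p q -> eqmodX N q r -> eqmodX N p r.
Proof. by case=> a -> [b ->]; exists (a + b); ring. Qed.

Lemma eqmodXD N p p' q q' :
  eqmodX N p p' -> eqmodX N q q' -> eqmodX N (p + q) (p' + q').
Proof. by case=> a -> [b ->]; exists (a + b); ring. Qed.

Lemma eqmodXN N p p' : eqmodX N p p' -> eqmodX N (- p) (- p').
Proof. by case=> a ->; exists (- a); ring. Qed.

Lemma eqmodXM N p p' q q' :
  eqmodX N p p' -> eqmodX N q q' -> eqmodX N (p * q) (p' * q').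
Proof. by case=> a -> [b ->]; exists (a * q' + p' * b + a * b * 'X^N); ring. Qed.

Lemma eqmodX_sum N (I : Type) (r : seq I) (P : pred I) (F G : I -> {poly int}) :
  (forall x, P x -> eqmodX N (F x) (G x)) ->
  eqmodX N (\sum_(x <- r | P x) F x) (\sum_(x <- r | P x) G x).
Proof.
move=> FG; elim/big_ind2: _ => //; first exact: eqmodX_refl.
by move=> *; apply: eqmodXD.
Qed.

Lemma eqmodX_sum0 N (I : Type) (r : seq I) (P : pred I) (F : I -> {poly int}) :
  (forall x, P x -> eqmodX N (F x) 0) -> eqmodX N (\sum_(x <- r | P x) F x) 0.
Proof.
move=> F0; apply: (big_ind (fun p => eqmodX N p 0)) => //; first exact: eqmodX_refl.
by move=> p q p0 q0; rewrite -[X in eqmodX N _ X]addr0; apply: eqmodXD.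
Qed.

Lemma eqmodX_Xn N e p : (N <= e)%N -> eqmodX N (p * 'X^e) 0.
Proof.
by move=> Ne; exists (p * 'X^(e - N)); rewrite add0r -mulrA -exprD subnK.
Qed.

Lemma eqmodX_1subXn N e : (N <= e)%N -> eqmodX N (1 - 'X^e) 1.
Proof.
move=> Ne; rewrite -{2}[1]subr0; apply: eqmodXD; first exact: eqmodX_refl.
by apply: eqmodXN; rewrite -[X in eqmodX _ X]mul1r; apply: eqmodX_Xn.
Qed.

Lemma eqmodX_prod1 N (I : Type) (r : seq I) (P : pred I) (e : I -> nat) :
  (forall x, P x -> (N <= e x)%N) ->
  eqmodX N (\prod_(x <- r | P x) (1 - 'X^(e x))) 1.
Proof.
move=> Ne; apply: (big_ind (fun p => eqmodX N p 1)); first exact: eqmodX_refl.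
  by move=> p q p1 q1; rewrite -[X in eqmodX N _ X]mulr1; apply: eqmodXM.
by move=> x /Ne; apply: eqmodX_1subXn.
Qed.

Lemma eqmodX_coef N p q n : eqmodX N p q -> (n < N)%N -> p`_n = q`_n.
Proof. by case=> r -> nN; rewrite coefD coefMXn nN addr0. Qed.

(** * The q-difference recurrence *)

(* (q^(n+1); q)_m with q = 'X *)
Definition qpoch (n m : nat) : {poly int} :=
  \prod_(j < m) (1 - 'X^(n + 1 + j)).

Lemma qpochS n m : qpoch n m.+1 = qpoch n m * (1 - 'X^(n + m + 1)).
Proof. by rewrite /qpoch big_ord_recr /= addnAC. Qed.

Lemma qpoch_recl n m : qpoch n m.+1 = (1 - 'X^(n.+1)) * qpoch n.+1 m.
Proof.
rewrite /qpoch big_ord_recl /= addn0 addn1; congr (_ * _).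
by apply: eq_bigr => j _; rewrite /bump /= addnA addnAC !addn1.
Qed.

(* The exponent is (2k+1) n(n+1)/2 - i n + k m n, written without subtracting i n. *)
Definition theta_term (k i m n : nat) : {poly int} :=
  (-1) ^+ n * 'X^(k * m * n + (2 * k + 1) * 'C(n, 2) + (2 * k + 1 - i) * n)
  * (1 - 'X^((m + 2 * n + 1) * i)) * qpoch n m.

Definition theta_sum (M k i m : nat) : {poly int} :=
  \sum_(n < M) theta_term k i m n.

Lemma theta_sum0 M k m : theta_sum M k 0 m = 0.
Proof.
by rewrite /theta_sum big1 // => n _; rewrite /theta_term muln0 subrr mulr0 mul0r.
Qed.

(* The part of [theta_term k i.+1 - theta_term k i] that telescopes in [n]. *)
Definition theta_rest (k i m n : nat) : {poly int} :=
  (-1) ^+ n * 'X^(k * m * n + (2 * k + 1) * 'C(n, 2) + (2 * k - i) * n)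
  * (1 - 'X^n) * qpoch n m.

(** Up to sign and a monomial, the left side is (1 - q^n) + q^((m+2n+1)i+n) (1 - q^(m+n+1)), times
    (q^(n+1);q)_m. The first summand gives [theta_rest] at n. In the second, the last factor
    lengthens the Pochhammer symbol and yields the leading half of the shifted term; the other half
    is [theta_rest] at n+1, because (1 - q^(n+1)) (q^(n+2);q)_m = (q^(n+1);q)_(m+1). *)
Lemma theta_term_rec k i m n : (i < k)%N ->
  theta_term k i.+1 m n - theta_term k i m n =
  'X^((m + 1) * i) * theta_term k (k - i) m.+1 n
  + theta_rest k i m n - theta_rest k i m n.+1.
Proof.
move=> ik; rewrite /theta_term /theta_rest -(mulrA _ (1 - 'X^(n.+1))) -qpoch_recl qpochS.
set b := 'C(n, 2).
have bS : 'C(n.+1, 2) = (b + n)%N by rewrite binS bin1.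
set e := (k * m * n + (2 * k + 1) * b)%N.
pose u : {poly int} := 'X^(e + (2 * k - i) * n).
have -> : (2 * k + 1 - i.+1 = 2 * k - i)%N by lia.
have -> : (2 * k + 1 - i = 2 * k - i + 1)%N by lia.
have -> : ((m + 2 * n + 1) * i.+1 = (m + n + 1) * i + n * i + (m + n + 1) + n)%N by nia.
have -> : ((m + 2 * n + 1) * i = (m + n + 1) * i + n * i)%N by nia.
have -> : 'X^(e + (2 * k - i + 1) * n) = u * 'X^n :> {poly int}.
  by rewrite /u -exprD; congr ('X^_); lia.
rewrite -/u.
(* Substituting k = i + d + 1 removes the truncated subtractions before [ring]. [E1] and [E2] are
   the exponents of the two halves of the shifted term; [E2] is also that of [theta_rest] at n+1. *)
have [d dk] : exists d, k = (i + d.+1)%N by exists (k - i.+1)%N; lia.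
have E1 : (k * m.+1 * n + (2 * k + 1) * b + (2 * k + 1 - (k - i)) * n + (m + 1) * i
  = e + (2 * k - i) * n + (m + n + 1) * i + n * i + n)%N.
  rewrite /e dk; have -> : (2 * (i + d.+1) + 1 - (i + d.+1 - i) = 2 * i + d.+1 + 1)%N by lia.
  have -> : (2 * (i + d.+1) - i = i + 2 * d.+1)%N by lia.
  ring.
have E2 : (k * m.+1 * n + (2 * k + 1) * b + (2 * k + 1 - (k - i)) * n + (m + 1) * i
   + (m.+1 + 2 * n + 1) * (k - i)
  = k * m * n.+1 + (2 * k + 1) * 'C(n.+1, 2) + (2 * k - i) * n.+1)%N.
  rewrite bS dk; have -> : (2 * (i + d.+1) + 1 - (i + d.+1 - i) = 2 * i + d.+1 + 1)%N by lia.
  have -> : (2 * (i + d.+1) - i = i + 2 * d.+1)%N by lia.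
  have -> : (i + d.+1 - i = d.+1)%N by lia.
  ring.
have shift (s w : {poly int}) a e1 f :
    'X^a * (s * 'X^e1 * (1 - 'X^f) * w) = s * ('X^(e1 + a) - 'X^(e1 + a + f)) * w.
  by rewrite !exprD; ring.
rewrite shift E2 E1 [(n + m)%N]addnC.
rewrite [in 'X^(e + _ + _ + _ + _)]exprD [in 'X^(e + _ + _ + _)]exprD [in 'X^(e + _ + _)]exprD -/u.
move: ('X^(k * m * n.+1 + _ + _)) => v.
rewrite !(exprD _ ((m + n + 1) * i)) !(exprD _ (_ + (m + n + 1))) exprS.
rewrite !(exprD _ (_ + n * i)) !(exprD _ ((m + n + 1) * i)).
set x := 'X^(m + n + 1); set y := 'X^(_ * i); set z := 'X^(n * i); set t := 'X^n.
move: (qpoch n m) => w.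
ring.
Qed.

(** Summation over n < M telescopes [theta_rest]: at n = 0 it vanishes through 1 - q^0, and at n = M
    its exponent is at least (2k - i) M >= N. *)
Lemma theta_sum_rec M N k i m : (i < k)%N -> (N <= M)%N ->
  eqmodX N (theta_sum M k i.+1 m)
    (theta_sum M k i m + 'X^((m + 1) * i) * theta_sum M k (k - i) m.+1).
Proof.
move=> ik NM.
have -> : theta_sum M k i.+1 m = theta_sum M k i m
    + 'X^((m + 1) * i) * theta_sum M k (k - i) m.+1 - theta_rest k i m M.
  suff D : theta_sum M k i.+1 m - theta_sum M k i m =
      'X^((m + 1) * i) * theta_sum M k (k - i) m.+1 - theta_rest k i m M.
    by rewrite -addrA -D addrC subrK.
  rewrite -sumrB mulr_sumr.
  have -> : \sum_(n < M) (theta_term k i.+1 m n - theta_term k i m n)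
     = \sum_(n < M) ('X^((m + 1) * i) * theta_term k (k - i) m.+1 n
        - (theta_rest k i m n.+1 - theta_rest k i m n)).
    by apply: eq_bigr => n _; rewrite theta_term_rec //; ring.
  rewrite sumrB -(big_mkord xpredT (fun n => theta_rest k i m n.+1 - theta_rest k i m n)).
  rewrite telescope_sumr //.
  have -> : theta_rest k i m 0 = 0 by rewrite /theta_rest expr0 subrr mulr0 mul0r.
  by rewrite subr0.
rewrite -[X in eqmodX _ _ X]subr0; apply: eqmodXD; first exact: eqmodX_refl.
apply: eqmodXN; rewrite /theta_rest.
have -> : (-1) ^+ M * 'X^(k * m * M + (2 * k + 1) * 'C(M, 2) + (2 * k - i) * M)
  * (1 - 'X^M) * qpoch M m
  = ((-1) ^+ M * (1 - 'X^M) * qpoch M m)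
    * 'X^(k * m * M + (2 * k + 1) * 'C(M, 2) + (2 * k - i) * M) by ring.
by apply: eqmodX_Xn; nia.
Qed.

(** Only n = 0 survives: for n >= 1 the exponent is at least k N n + (2k+1-i) n >= N+1, and the
    factor 1 - q^((N+1)i) at n = 0 is congruent to 1. *)
Lemma theta_sum_base N k i : (0 < i)%N -> (i <= k)%N ->
  eqmodX N.+1 (theta_sum N.+1 k i N) (qpoch 0 N).
Proof.
move=> i0 ik; rewrite /theta_sum big_ord_recl -[X in eqmodX _ _ X]addr0.
apply: eqmodXD.
  rewrite (_ : theta_term _ _ _ _ = (1 - 'X^((N + 1) * i)) * qpoch 0 N); last first.
    by rewrite /theta_term [nat_of_ord _]/= bin0n !muln0 !addn0 !expr0 !mul1r.
  rewrite -[X in eqmodX _ _ X]mul1r; apply: eqmodXM; last exact: eqmodX_refl.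
  by apply: eqmodX_1subXn; nia.
apply: eqmodX_sum0 => n _; rewrite /theta_term -mulrA mulrAC.
by apply: eqmodX_Xn; rewrite /= /bump /=; nia.
Qed.

(** * The Jacobi triple product *)

(** The Gaussian binomial coefficient through the q-Pascal rule, which avoids division. *)
Fixpoint qbin (R : pzSemiRingType) (Q : R) (l j : nat) : R :=
  match l, j with
  | _, 0 => 1
  | 0, _.+1 => 0
  | l'.+1, j'.+1 => qbin Q l' j' + Q ^+ j * qbin Q l' j
  end.

Lemma qbin0 (R : pzSemiRingType) (Q : R) l : qbin Q l 0 = 1.
Proof. by case: l. Qed.

Lemma qbin_gt (R : pzSemiRingType) (Q : R) l j : (l < j)%N -> qbin Q l j = 0.
Proof.
elim: l j => [|l IH] [|j] //= lj; rewrite !IH ?mulr0 ?addr0 //; lia.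
Qed.

(** Splitting off the factor j = 0 leaves the same product with y Q in place of y; the q-Pascal rule
    then merges the two contributions to each power of y. *)
Lemma qbinomial (R : comPzRingType) (Q x y : R) l :
  \prod_(j < l) (x + y * Q ^+ j) =
  \sum_(j < l.+1) Q ^+ 'C(j, 2) * qbin Q l j * y ^+ j * x ^+ (l - j).
Proof.
elim: l y => [|l IH] y.
  by rewrite big_ord0 big_ord_recl big_ord0 /= bin0n subnn !expr0 !mulr1 addr0.
rewrite big_ord_recl expr0 mulr1.
under eq_bigr => j _ do rewrite lift0 exprS mulrA.
rewrite {}IH [RHS]big_ord_recl [nat_of_ord ord0]/= qbin0 bin0n subn0 !expr0 !mul1r.
under [X in _ = _ + X]eq_bigr => j _.
  rewrite lift0 subSS binS bin1 /= mulrDr !mulrDl; over.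
rewrite big_split /= mulrDl addrCA addrC; congr (_ + _).
  rewrite [in RHS]big_ord_recr /= qbin_gt // !(mulr0, mul0r) addr0.
  rewrite big_ord_recl [nat_of_ord ord0]/= qbin0 bin0n subn0 !expr0 !mul1r mulrDr -exprS.
  congr (_ + _); rewrite mulr_sumr; apply: eq_bigr => j _.
  rewrite lift0 binS bin1 exprMn.
  have -> : (l - j = (l - j.+1).+1)%N by have := ltn_ord j; lia.
  by rewrite !exprD !exprS; ring.
rewrite mulr_sumr; apply: eq_bigr => j _.
by rewrite exprMn !exprD !exprS; ring.
Qed.

(** With u = Q^(j+1) and v = Q^(l-j), the induction step is 1 - u v = (1 - u) + u (1 - v). *)
Lemma qbin_qpoch (R : comPzRingType) (Q : R) l j : (j <= l)%N ->
  qbin Q l j * (\prod_(s < j) (1 - Q ^+ s.+1) * \prod_(s < l - j) (1 - Q ^+ s.+1))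
  = \prod_(s < l) (1 - Q ^+ s.+1).
Proof.
elim: l j => [|l IH] [|j] //= jl.
- by rewrite big_ord0 !mul1r.
- by rewrite big_ord0 !mul1r.
rewrite subSS [RHS]big_ord_recr /= -(IH j) // (big_ord_recr j) /=.
move: jl; rewrite ltnS leq_eqVlt => /predU1P[->|jl].
  by rewrite (@qbin_gt _ _ l l.+1) // mulr0 addr0; ring.
have E := IH _ jl; have := IH j (ltnW jl); move: E.
have -> : (l - j = (l - j.+1).+1)%N by lia.
rewrite !big_ord_recr /=; set A := \prod_(_ < j) _; set B := \prod_(_ < _ - _) _.
have -> : (l.+1 = j.+1 + (l - j.+1).+1)%N by lia.
move: (\prod_(_ < l) _) => P; rewrite exprD.
move: (Q ^+ j.+1) (Q ^+ (l - j.+1).+1) => u v.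
move: (qbin Q l j) (qbin Q l j.+1) => X Y EY EX.
transitivity ((1 - u) * (X * (A * (B * (1 - v)))) + u * (1 - v) * (Y * (A * (1 - u) * B))).
  by ring.
by rewrite EY EX; ring.
Qed.

(* With [Q = a b], this is the q-binomial theorem for [x = Q ^+ M], [y = - a] and
   [l = M + M], divided by the monomial [W]. *)
Lemma finite_jacobi_triple (R : idomainType) (a b : R) M :
  a != 0 -> b != 0 ->
  \prod_(j < M) ((1 - a * (a * b) ^+ j) * (1 - b * (a * b) ^+ j)) =
  \sum_(n < M) (- b) ^+ n.+1 * (a * b) ^+ 'C(n.+1, 2) * qbin (a * b) (M + M) (M - n.+1)
  + \sum_(n < M.+1) (- a) ^+ n * (a * b) ^+ 'C(n, 2) * qbin (a * b) (M + M) (M + n).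
Proof.
move=> a0 b0; set Q := a * b.
have Q0 : Q != 0 by rewrite mulf_neq0.
(* [W] gathers the monomials taken out of the factors: Q^M - a Q^(M-1-j) = - a Q^(M-1-j) (1 - b Q^j)
   in the lower half, Q^M - a Q^(M+j) = Q^M (1 - a Q^j) in the upper half. *)
pose W := Q ^+ ('C(M, 2) + M * M) * (- a) ^+ M.
have W0 : W != 0 by rewrite mulf_neq0 ?expf_neq0 ?oppr_eq0.
have binD p r : 'C(p + r, 2) = ('C(p, 2) + 'C(r, 2) + p * r)%N.
  elim: p => [|p IH]; first by rewrite add0n bin0n mul0n addn0.
  by rewrite addSn !binS !bin1 IH; lia.
apply: (mulfI W0).
have := qbinomial Q (Q ^+ M) (- a) (M + M).
rewrite -addnS [X in X = _ -> _]big_split_ord [X in _ = X -> _]big_split_ord /=.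
set S1 := \sum_(i < M) _; set S2 := \sum_(i < M.+1) _.
have -> : S1 = W * \sum_(n < M) (- b) ^+ n.+1 * Q ^+ 'C(n.+1, 2) * qbin Q (M + M) (M - n.+1).
  rewrite /S1 (reindex_inj rev_ord_inj) mulr_sumr; apply: eq_bigr => n _ /=.
  set p := n.+1; have pM : (p <= M)%N by rewrite /p.
  (* The term has p fewer factors - a than [W]; they are absorbed through (- a)^p (- b)^p = Q^p. *)
  have E : Q ^+ 'C(M - p, 2) * (- a) ^+ (M - p) * (Q ^+ M) ^+ (M + M - (M - p))
      = W * ((- b) ^+ p * Q ^+ 'C(p, 2)).
    have -> : W = Q ^+ ('C(M, 2) + M * M) * ((- a) ^+ (M - p) * (- a) ^+ p).
      by rewrite -exprD subnK.
    rewrite [RHS](_ : _ = Q ^+ ('C(M, 2) + M * M) * (- a) ^+ (M - p)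
      * ((- a) ^+ p * (- b) ^+ p * Q ^+ 'C(p, 2))); last by ring.
    rewrite -exprMn mulrNN -/Q -exprM -exprD mulrAC -exprD mulrAC -exprD; congr (Q ^+ _ * _).
    have p2 : (p * p = 'C(p, 2) + 'C(p, 2) + p)%N.
      by elim: (p) => // r IH; rewrite binS bin1; lia.
    have [d dM] : exists d, M = (d + p)%N by exists (M - p)%N; lia.
    have -> : (M + M - (M - p) = M + p)%N by lia.
    by rewrite dM addnK binD; nia.
  have -> : Q ^+ 'C(M - p, 2) * qbin Q (M + M) (M - p) * (- a) ^+ (M - p) * (Q ^+ M) ^+ (M + M - (M - p))
     = Q ^+ 'C(M - p, 2) * (- a) ^+ (M - p) * (Q ^+ M) ^+ (M + M - (M - p)) * qbin Q (M + M) (M - p) by ring.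
  by rewrite E; ring.
have -> : S2 = W * \sum_(n < M.+1) (- a) ^+ n * Q ^+ 'C(n, 2) * qbin Q (M + M) (M + n).
  rewrite /S2 mulr_sumr; apply: eq_bigr => n _.
  have nM : (n <= M)%N by rewrite -ltnS.
  rewrite /W -exprM [(- a) ^+ (M + n)]exprD.
  have -> : Q ^+ 'C(M + n, 2) * qbin Q (M + M) (M + n) * ((- a) ^+ M * (- a) ^+ n) * Q ^+ (M * (M + M - (M + n)))
   = Q ^+ 'C(M + n, 2) * Q ^+ (M * (M + M - (M + n))) * (qbin Q (M + M) (M + n) * ((- a) ^+ M * (- a) ^+ n)) by ring.
  have -> : Q ^+ 'C(M + n, 2) * Q ^+ (M * (M + M - (M + n))) = Q ^+ ('C(M, 2) + M * M) * Q ^+ 'C(n, 2).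
    rewrite -!exprD; congr (Q ^+ _).
    have [d dM] : exists d, M = (d + n)%N by exists (M - n)%N; lia.
    have -> : (M + M - (M + n) = d)%N by lia.
    by rewrite binD; nia.
  by ring.
rewrite -mulrDr => <-; rewrite big_split /=.
rewrite [\prod_(i < M) (Q ^+ M + - a * Q ^+ i)](reindex_inj rev_ord_inj) /=.
have WE : W = \prod_(j < M) (- a * Q ^+ (M - j.+1)) * \prod_(j < M) Q ^+ M.
  rewrite /W big_split /= !prodr_const card_ord -exprM.
  have -> : \prod_(j < M) Q ^+ (M - j.+1) = \prod_(j < M) Q ^+ j.
    by rewrite [RHS](reindex_inj rev_ord_inj).
  rewrite -expr_sum exprD.
  have -> : (\sum_(j < M) j = 'C(M, 2))%N by rewrite -bin2_sum big_mkord.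
  by ring.
rewrite WE -!big_split /=; apply: eq_bigr => j _.
have QM : Q ^+ (M - j.+1) * Q ^+ j * (a * b) = Q ^+ M.
  by rewrite -mulrA -exprSr -exprD subnK.
by rewrite -/Q exprD -{2}QM; ring.
Qed.

Lemma onesubX_neq0 e : (0 < e)%N -> 1 - 'X^e != 0 :> {poly int}.
Proof.
move=> e0; apply/eqP => /(congr1 (fun p : {poly int} => p`_0)).
by rewrite coefB coef1 coefXn coef0 /= (ltn_eqF e0).
Qed.

(** With Q = q^c, [qbin_qpoch] shows that the coefficient times (Q)_(M-p) is the product of the 1 -
    Q^s with M+p < s <= 2M. The rest of [T] consists of those with M-p < s <= M, and all these
    factors are 1 modulo q^(c(M-p+1)). *)
Lemma qbin_mod c M p N : (0 < c)%N -> (p <= M)%N -> (N <= c * (M - p).+1)%N ->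
  let T := \prod_(j < M) (1 - 'X^c ^+ j.+1) : {poly int} in
  eqmodX N (qbin 'X^c (M + M) (M + p) * T) 1
  /\ eqmodX N (qbin 'X^c (M + M) (M - p) * T) 1.
Proof.
move=> c0 pM NM T; pose P n : {poly int} := \prod_(j < n) (1 - 'X^c ^+ j.+1).
have P0 n : P n != 0.
  by apply/prodf_neq0 => j _; rewrite -exprM onesubX_neq0 //; lia.
have PD n m : P (n + m)%N = P n * \prod_(j < m) (1 - 'X^(c * (n + j).+1)).
  rewrite /P big_split_ord; congr (_ * _).
  by apply: eq_bigr => j _; rewrite -exprM.
have TE : T = P (M - p)%N * \prod_(j < p) (1 - 'X^(c * ((M - p) + j).+1)).
  by rewrite -PD subnK.
have main (g : {poly int}) : g * (P (M + p)%N * P (M - p)%N) = P (M + M)%N ->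
    eqmodX N (g * T) 1.
  move=> gP; have gP' : g * P (M - p)%N = \prod_(j < M - p) (1 - 'X^(c * (M + p + j).+1)).
    apply: (mulfI (P0 (M + p)%N)); rewrite -PD mulrCA gP; congr (P _); lia.
  rewrite TE mulrA gP' -[X in eqmodX N _ X]mulr1.
  by apply: eqmodXM; apply: eqmodX_prod1 => j _; nia.
split; apply: main.
  have := @qbin_qpoch _ ('X^c : {poly int}) (M + M) (M + p).
  have -> : (M + M - (M + p) = M - p)%N by lia.
  by apply; lia.
have := @qbin_qpoch _ ('X^c : {poly int}) (M + M) (M - p).
have -> : (M + M - (M - p) = M + p)%N by lia.
by rewrite [P _ * _]mulrC; apply; lia.
Qed.

Definition gordon_residue (k i r : nat) : bool :=
  (r %% (2 * k + 1) \in [:: 0; i; 2 * k + 1 - i])%N.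

(** Induction over blocks of c = 2k+1 integers. A block runs from M c + 1 to M c + c, so residue 0
    is its last entry; i, c - i and c are distinct because 0 < i <= k. *)
Lemma prod_gordon_residue k i M : (0 < i)%N -> (i <= k)%N ->
  \prod_(1 <= r < (M * (2 * k + 1)).+1 | gordon_residue k i r) (1 - 'X^r) =
  \prod_(j < M) ((1 - 'X^i * 'X^(2 * k + 1) ^+ j)
    * (1 - 'X^(2 * k + 1 - i) * 'X^(2 * k + 1) ^+ j))
  * \prod_(j < M) (1 - 'X^(2 * k + 1) ^+ j.+1) :> {poly int}.
Proof.
move=> i0 ik; set c := (2 * k + 1)%N.
elim: M => [|M IH]; first by rewrite mul0n big_nil !big_ord0 mulr1.
rewrite (@big_cat_nat _ _ _ (M * c).+1) //=; last by rewrite mulSn; lia.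
rewrite IH !big_ord_recr /= mulrACA; congr (_ * _).
have -> : index_iota (M * c).+1 (M.+1 * c).+1 = [seq (M * c + r)%N | r <- iota 1 c].
  rewrite /index_iota mulSn -(iotaDl (M * c) 1 c) addn1; congr iota; lia.
rewrite big_map.
have -> : \prod_(r <- iota 1 c | gordon_residue k i (M * c + r)) (1 - 'X^(M * c + r))
  = \prod_(r <- iota 1 c | r \in [:: i; c - i; c]%N) (1 - 'X^(M * c + r)) :> {poly int}.
  rewrite big_seq_cond [RHS]big_seq_cond; apply: eq_bigl => r.
  rewrite mem_iota; case: (boolP (1 <= r < 1 + c)%N) => //= rc.
  rewrite /gordon_residue modnMDl -/c !inE.
  have [->|rc'] := eqVneq r c; first by rewrite modnn eqxx !orbT.
  rewrite modn_small; last by lia.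
  by rewrite orbF; have -> : (r == 0)%N = false by lia.
rewrite -big_filter.
rewrite (perm_big [:: i; c - i; c]%N); last first.
  apply: uniq_perm; first by rewrite filter_uniq // iota_uniq.
    by rewrite /= !inE /c; lia.
  move=> r; rewrite mem_filter mem_iota; case: (boolP (r \in _)) => //=.
  by rewrite !inE /c; lia.
rewrite !big_cons big_nil /= mulr1 mulrA -!exprM -!exprD.
by congr ((1 - 'X^_) * (1 - 'X^_) * (1 - 'X^_)); rewrite /c; lia.
Qed.

(** The finite triple product for a = q^i, b = q^(c-i) and M = N+1 is multiplied by the 1 -
    q^(c(j+1)), which cancel the Gaussian binomials modulo q^(N+1). *)
Lemma jacobi_triple_mod N k i : (0 < i)%N -> (i <= k)%N ->
  eqmodX N.+1 (theta_sum N.+1 k i 0)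
    (\prod_(1 <= r < N.+1 | gordon_residue k i r) (1 - 'X^r)).
Proof.
move=> i0 ik; set c := (2 * k + 1)%N.
pose a : {poly int} := 'X^i; pose b : {poly int} := 'X^(c - i).
have ab : a * b = 'X^c by rewrite /a /b -exprD; congr ('X^_); rewrite /c; lia.
have a0 : a != 0 by rewrite expf_neq0 // polyX_eq0.
have b0 : b != 0 by rewrite expf_neq0 // polyX_eq0.
have := prod_gordon_residue N.+1 i0 ik; rewrite -/c.
have := finite_jacobi_triple N.+1 a0 b0; rewrite ab => -> E.
apply: (@eqmodX_trans _ (\prod_(1 <= r < (N.+1 * c).+1 | gordon_residue k i r) (1 - 'X^r)));
  last first.
  rewrite (@big_cat_nat _ _ _ N.+1) //=; last by rewrite /c; nia.
  rewrite -[X in eqmodX _ _ X]mulr1; apply: eqmodXM; first exact: eqmodX_refl.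
  rewrite big_seq_cond; apply: eqmodX_prod1 => r.
  by rewrite mem_index_iota => /andP[/andP[]].
rewrite {}E; apply: eqmodX_sym; rewrite mulrDl !mulr_suml /a /b [X in eqmodX _ (_ + X) _]big_ord_recl.
(* The coefficient is known only modulo q^(c(N+2-p)), which is too weak for large p; the monomial
   q^(d p) makes up for it. *)
have T1 n p e d : (p <= N.+1)%N -> (0 < d)%N -> (d <= c)%N -> (e = d * p)%N ->
  n = (N.+1 + p)%N \/ n = (N.+1 - p)%N ->
  eqmodX N.+1 ((- 'X^d) ^+ p * 'X^c ^+ 'C(p, 2) * qbin 'X^c (N.+1 + N.+1) n *
    \prod_(j < N.+1) (1 - 'X^c ^+ j.+1)) ((-1) ^+ p * 'X^(e + c * 'C(p, 2))).
  move=> pN d0 dc -> nE.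
  set T := \prod_(j < N.+1) _.
  rewrite (_ : _ * T = (-1) ^+ p * 'X^(d * p + c * 'C(p, 2)) * (qbin 'X^c (N.+1 + N.+1) n * T)); last first.
    by rewrite -['X^d]mul1r -mulNr exprMn exprD !exprM; ring.
  set s := (-1) ^+ p; set q := qbin _ _ _ * _.
  have [r qE] : eqmodX (c * (N.+1 - p).+1) q 1.
    have c0 : (0 < c)%N by rewrite /c addn1.
    have [q1 q2] := qbin_mod c0 pN (leqnn _).
    by case: nE => nE; rewrite /q nE.
  rewrite {}qE mulrDr mulr1 -[X in eqmodX _ _ X]addr0; apply: eqmodXD; first exact: eqmodX_refl.
  have -> : s * 'X^(d * p + c * 'C(p, 2)) * (r * 'X^(c * (N.+1 - p).+1))
    = s * r * 'X^(d * p + c * 'C(p, 2) + c * (N.+1 - p).+1) by rewrite !exprD; ring.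
  by apply: eqmodX_Xn; nia.
have ci0 : (0 < c - i)%N by rewrite /c; lia.
have cic : (c - i <= c)%N by lia.
have ic : (i <= c)%N by rewrite /c; lia.
apply: (@eqmodX_trans _ (\sum_(n < N.+1) ((-1) ^+ n.+1 * 'X^((c - i) * n.+1 + c * 'C(n.+1, 2)))
  + (1 + \sum_(n < N.+1) ((-1) ^+ n.+1 * 'X^(i * n.+1 + c * 'C(n.+1, 2)))))).
  apply: eqmodXD.
    apply: eqmodX_sum => n _; by apply: T1 => //; right.
  apply: eqmodXD.
    have := T1 (N.+1 + 0)%N 0 0 i (leq0n _) i0 ic (esym (muln0 _)) (or_introl erefl).
    by rewrite bin0n muln0 !expr0 mul1r.
  apply: eqmodX_sum => n _; by apply: T1; rewrite ?lift0 //; left.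
(* The last term on the side of b has exponent at least N+1 and is dropped. *)
rewrite big_ord_recr /= addrAC.
rewrite -[X in eqmodX _ _ X]addr0; apply: eqmodXD; last by apply: eqmodX_Xn; nia.
rewrite /theta_sum.
(* At m = 0 the two halves of term n are term n on the side of b and term n+1 on the side of a. *)
have -> : \sum_(n < N.+1) theta_term k i 0 n =
  \sum_(n < N.+1) (-1) ^+ n * 'X^((c - i) * n + c * 'C(n, 2)) +
  \sum_(n < N.+1) (-1) ^+ n.+1 * 'X^(i * n.+1 + c * 'C(n.+1, 2)).
  rewrite -big_split /=; apply: eq_bigr => n _; rewrite /theta_term /qpoch big_ord0.
  rewrite muln0 mul0n !add0n mulr1 -/c binS bin1.
  have -> : 'X^(i * n.+1 + c * ('C(n, 2) + n)) = 'X^(c * 'C(n, 2) + (c - i) * n) * 'X^((2 * n + 1) * i) :> {poly int}.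
    rewrite -exprD; congr ('X^_).
    have [d ->] : exists d, c = (i + d)%N by exists (c - i)%N; lia.
    by rewrite addKn; nia.
  by rewrite [((c - i) * n + _)%N]addnC exprS; ring.
rewrite [X in eqmodX _ _ (X + _)]big_ord_recl /=.
rewrite expr0 mul1r !muln0 addn0 expr0 addrCA addrA; exact: eqmodX_refl.
Qed.

(** * Gordon's theorem for integer partitions *)

(* Entry [j] of the sequence is the multiplicity of the part [m + j + 1]. *)
Fixpoint weight (m : nat) (s : seq nat) : nat :=
  if s is f :: s' then m.+1 * f + weight m.+1 s' else 0.

Definition genfun (m : nat) (l : seq (seq nat)) : {poly int} :=
  \sum_(s <- l) 'X^(weight m s).

Lemma genfun_cons m (l : nat -> seq (seq nat)) (r : seq nat) :
  genfun m (flatten [seq [seq f :: s | s <- l f] | f <- r]) =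
  \sum_(f <- r) 'X^(m.+1 * f) * genfun m.+1 (l f).
Proof.
rewrite /genfun big_flatten big_map; apply: eq_bigr => f _.
by rewrite big_map mulr_sumr; apply: eq_bigr => s _; rewrite /= exprD.
Qed.

Lemma genfun_coef m l n :
  (genfun m l)`_n = (count (fun s => weight m s == n) l)%:R.
Proof.
rewrite /genfun coef_sum -sum1_count natr_sum [RHS]big_mkcond /=.
by apply: eq_bigr => s _; rewrite coefXn eq_sym; case: eqP.
Qed.

(** A multiplicity f leaves the bound k - f for the next one. Nothing depends on the first part
    size, so no [m] is carried. *)
Fixpoint gordon_seqs (k i L : nat) : seq (seq nat) :=
  if L is L'.+1 then
    flatten [seq [seq f :: s | s <- gordon_seqs k (k - f) L'] | f <- iota 0 i]
  else [:: [::]].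

(** The cap N on multiplicities keeps the list finite; it excludes no partition of N. *)
Fixpoint residue_seqs (N k i m L : nat) : seq (seq nat) :=
  if L is L'.+1 then
    flatten [seq [seq f :: s | s <- residue_seqs N k i m.+1 L']
            | f <- iota 0 (if gordon_residue k i m.+1 then 1 else N.+1)]
  else [:: [::]].

Lemma genfun_gordon_rec k i m L :
  genfun m (gordon_seqs k i.+1 L.+1) =
  genfun m (gordon_seqs k i L.+1)
  + 'X^((m + 1) * i) * genfun m.+1 (gordon_seqs k (k - i) L).
Proof.
rewrite /gordon_seqs -/gordon_seqs !(@genfun_cons m (fun f => gordon_seqs k (k - f) L)).
by rewrite -addn1 iotaD big_cat big_seq1 add0n addn1.
Qed.

(** Outer induction on L, inner induction on i: both sides obey the same recurrence and vanish at i
    = 0 when L > 0. The recurrence uses the outer hypothesis only at k - i >= 1. *)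
Lemma genfun_gordon_theta N k i m L : (m + L = N)%N -> (0 < i)%N -> (i <= k)%N ->
  eqmodX N.+1 (qpoch 0 N * genfun m (gordon_seqs k i L)) (theta_sum N.+1 k i m).
Proof.
elim: L m i => [|L IH] m i mN i0 ik.
  move: mN; rewrite addn0 => ->; rewrite /genfun big_seq1 mulr1.
  by apply: eqmodX_sym; apply: theta_sum_base.
elim: i ik {i0} => [|i IHi] ik.
  by rewrite theta_sum0 /genfun big_nil mulr0; apply: eqmodX_refl.
rewrite genfun_gordon_rec mulrDr mulrCA.
apply: eqmodX_trans (eqmodX_sym (theta_sum_rec m ik (leqnn _))).
apply: eqmodXD; first by apply: IHi; apply: ltnW.
by apply: eqmodXM; [exact: eqmodX_refl | apply: IH; lia].
Qed.

Lemma genfun_residue N k i m L :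
  genfun m (residue_seqs N k i m L) =
  \prod_(m.+1 <= r < (m + L).+1 | ~~ gordon_residue k i r) \sum_(f < N.+1) 'X^(r * f).
Proof.
elim: L m => [|L IH] m.
  by rewrite addn0 big_geq // /genfun big_seq1.
rewrite /= (@genfun_cons m (fun=> residue_seqs N k i m.+1 L)) -mulr_suml IH addSnnS.
rewrite [in RHS]big_ltn_cond; last by lia.
case: ifP => _ /=; first by rewrite big_seq1 muln0 expr0 mul1r.
by rewrite -(big_mkord xpredT (fun f => 'X^(m.+1 * f))).
Qed.

Lemma geometric_mod N r : (0 < r)%N ->
  eqmodX N.+1 ((1 - 'X^r) * \sum_(f < N.+1) 'X^(r * f)) 1.
Proof.
move=> r0.
have -> : (1 - 'X^r) * \sum_(f < N.+1) 'X^(r * f) = 1 - 'X^(r * N.+1) :> {poly int}.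
  elim: N => [|N IH]; first by rewrite big_ord1 muln0 muln1 expr0 mulr1.
  by rewrite big_ord_recr /= mulrDr IH [in RHS]mulnS exprD; ring.
by apply: eqmodX_1subXn; nia.
Qed.

(** Modulo q^(n+1), [I r] inverts 1 - q^r, so multiplying [G] by (q)_n and by every [I r] changes
    nothing. Replacing (q)_n [G] by the product over the residues 0, i, -i leaves only the [I r] of
    the other residues. *)
Lemma count_gordon_residue k i n : (0 < i)%N -> (i <= k)%N ->
  count (fun s => weight 0 s == n) (gordon_seqs k i n) =
  count (fun s => weight 0 s == n) (residue_seqs n k i 0 n).
Proof.
move=> i0 ik; apply/eqP; rewrite -(eqr_nat int) -!genfun_coef; apply/eqP.
apply: (@eqmodX_coef n.+1) => //.
set G := genfun 0 _; pose I r : {poly int} := \sum_(f < n.+1) 'X^(r * f).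
have E : qpoch 0 n = \prod_(1 <= r < n.+1) (1 - 'X^r).
  by rewrite big_add1 big_mkord; apply: eq_bigr => j _; rewrite add0n add1n.
have H := eqmodX_trans (@genfun_gordon_theta n k i 0 n (add0n _) i0 ik)
  (jacobi_triple_mod n i0 ik).
have J (P : pred nat) :
    eqmodX n.+1 ((\prod_(1 <= r < n.+1 | P r) (1 - 'X^r)) * \prod_(1 <= r < n.+1 | P r) I r) 1.
  rewrite -big_split /= big_seq_cond.
  apply: (big_ind (fun p => eqmodX n.+1 p 1)); first exact: eqmodX_refl.
    by move=> p q p1 q1; rewrite -[X in eqmodX _ _ X]mulr1; apply: eqmodXM.
  by move=> r; rewrite mem_index_iota => /andP[/andP[r0 _] _]; apply: geometric_mod.
rewrite genfun_residue add0n; set B := \prod_(_ <= r < _ | ~~ _) _.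
apply: (@eqmodX_trans _ (G * (qpoch 0 n * \prod_(1 <= r < n.+1) I r))).
  rewrite -{1}[G]mulr1; apply: eqmodXM; first exact: eqmodX_refl.
  by apply: eqmodX_sym; rewrite E; apply: J.
rewrite mulrA [G * _]mulrC.
apply: (eqmodX_trans (eqmodXM H (eqmodX_refl _ _))).
rewrite [\prod_(1 <= r < n.+1) I r](bigID (gordon_residue k i)) /= mulrA -[X in eqmodX _ _ X]mul1r.
by apply: eqmodXM; [apply: J | apply: eqmodX_refl].
Qed.

(** Entries past the end read as 0, so for the last entry the sum condition follows from its own
    bound, at most k. *)
Lemma mem_gordon_seqs k i L s : (0 < i)%N -> (i <= k)%N ->
  s \in gordon_seqs k i L <->
  [/\ size s = L, (nth 0 s 0 < i)%N & forall j, (nth 0 s j + nth 0 s j.+1 < k)%N].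
Proof.
elim: L i s => [|L IH] i s i0 ik.
  rewrite inE; split=> [/eqP->|[/size0nil-> //]].
  by split=> // j; rewrite !nth_nil; lia.
split=> [/flatten_mapP[f]|[]].
  rewrite mem_iota /= => fi /mapP[t]; rewrite IH; [|lia..].
  move=> [tL t0 tk] ->; split=> /=; [by rewrite tL | by [] |].
  by case=> [|j]; [move: t0 => /=; lia | apply: tk].
case: s => //= f t [tL] fi tk; apply/flatten_mapP; exists f; first by rewrite mem_iota.
apply/mapP; exists t => //; rewrite IH; [|lia..].
by split=> //; [have := tk 0%N => /=; lia | move=> j; have := tk j.+1].
Qed.

Lemma mem_residue_seqs N k i m L s :
  s \in residue_seqs N k i m L <->
  [/\ size s = L, forall j, (nth 0 s j <= N)%N
    & forall j, gordon_residue k i (m + j).+1 -> nth 0 s j = 0%N].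
Proof.
elim: L m s => [|L IH] m s.
  rewrite inE; split=> [/eqP->|[/size0nil-> //]].
  by split=> // j; rewrite nth_nil.
split=> [/flatten_mapP[f]|[]].
  rewrite mem_iota /= => fi /mapP[t] /IH[tL tN tr] ->.
  split=> /=; [by rewrite tL | case=> [|j] //= | case=> [|j] /=].
  - by case: ifP fi => _; lia.
  - by rewrite addn0 => b; move: fi; rewrite b; lia.
  - by rewrite addnS -addSn; apply: tr.
case: s => //= f t [tL] tN tr; apply/flatten_mapP; exists f.
  rewrite mem_iota; case: ifP => b; last by have := tN 0%N; rewrite /=; lia.
  by have := tr 0%N; rewrite addn0 b => /(_ isT) /= ->.
apply/mapP; exists t => //; apply/IH; split=> // j; first exact: (tN j.+1).
by rewrite addSn -addnS => /tr.
Qed.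

Lemma uniq_flatten_cons (l : nat -> seq (seq nat)) (r : seq nat) :
  uniq r -> (forall f, uniq (l f)) ->
  uniq (flatten [seq [seq f :: s | s <- l f] | f <- r]).
Proof.
move=> + lu; elim: r => //= f r IH /andP[fr ru].
rewrite cat_uniq IH // andbT map_inj_uniq ?lu /=; last by move=> s t [].
apply/hasPn => s /flatten_mapP[g gr /mapP[t _ ->]].
by apply/mapP => -[u _ [gf _]]; move: fr; rewrite -gf gr.
Qed.

Lemma gordon_seqs_uniq k i L : uniq (gordon_seqs k i L).
Proof.
by elim: L i => //= L IH i; apply: (@uniq_flatten_cons (fun f => gordon_seqs k (k - f) L)) => //;
  apply: iota_uniq.
Qed.

Lemma residue_seqs_uniq N k i m L : uniq (residue_seqs N k i m L).
Proof.
by elim: L m => //= L IH m; apply: (@uniq_flatten_cons (fun=> residue_seqs N k i m.+1 L)) => //;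
  apply: iota_uniq.
Qed.

(** * From multiplicity sequences to multisets of positive integers *)

Local Open Scope mset_scope.

Fixpoint parts (m : nat) (s : seq nat) : seq nat :=
  if s is f :: s' then nseq f m.+1 ++ parts m.+1 s' else [::].

Lemma count_mem_parts m s x :
  count_mem x (parts m s) = if (m < x)%N then nth 0%N s (x - m.+1) else 0%N.
Proof.
elim: s m => [|f s IH] m /=; first by rewrite nth_nil if_same.
rewrite count_cat IH count_nseq /=; case: (ltngtP m.+1 x) => mx.
- by rewrite mul0n add0n (_ : x - m.+1 = (x - m.+2).+1)%N //; lia.
- by rewrite addn0 mul0n.
- by rewrite -mx subnn mul1n addn0.
Qed.

Lemma sum_parts m s : (\sum_(x <- parts m s) x = weight m s)%N.
Proof.
elim: s m => [|f s IH] m /=; first by rewrite big_nil.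
by rewrite big_cat IH /= big_nseq iter_addn_0.
Qed.

Definition mset_weight (l : {mset nat}) : nat := (\sum_(x <- l) x)%N.

Definition gordon_mset (k i : nat) (l : {mset nat}) : Prop :=
  [/\ l 0%N = 0%N, (l 1%N < i)%N & forall x, (l x + l x.+1 < k)%N].

(** The part 0 is excluded too, since its residue is 0. *)
Definition residue_mset (k i : nat) (l : {mset nat}) : Prop :=
  forall x, gordon_residue k i x -> l x = 0%N.

Definition mset_of_mults (s : seq nat) : {mset nat} := seq_mset (parts 0 s).

Definition mults (n : nat) (l : {mset nat}) : seq nat := mkseq (fun j => l j.+1) n.

Lemma mset_of_multsE s x : mset_of_mults s x = if x is j.+1 then nth 0%N s j else 0%N.
Proof. by rewrite mset_seqE count_mem_parts; case: x => //= j; rewrite subn1. Qed.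

Lemma mset_of_mults_weight s : mset_weight (mset_of_mults s) = weight 0 s.
Proof.
by rewrite -sum_parts /mset_weight; apply: perm_big; apply: perm_eq_seq_mset.
Qed.

Lemma mset_of_mults_inj n (s t : seq nat) : size s = n -> size t = n ->
  mset_of_mults s = mset_of_mults t -> s = t.
Proof.
move=> sn tn st; apply: (@eq_from_nth _ 0%N) => [|j _]; first by rewrite sn tn.
by have /(congr1 (fun l : {mset nat} => l j.+1)) := st; rewrite !mset_of_multsE.
Qed.

Lemma mem_le_weight (l : {mset nat}) x : x \in l -> (x <= mset_weight l)%N.
Proof. by move=> xl; rewrite /mset_weight (big_rem x) //= leq_addr. Qed.

(** Recording n multiplicities suffices because no part exceeds the weight. *)
Lemma multsK n (l : {mset nat}) : l 0%N = 0%N -> mset_weight l = n -> mset_of_mults (mults n l) = l.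
Proof.
move=> l0 ln; apply/msetP => -[|j]; rewrite mset_of_multsE //.
have [jn|nj] := ltnP j n; first by rewrite nth_mkseq.
rewrite nth_default ?size_mkseq //; apply/esym/eqP; rewrite mset_eq0.
by apply/negP => /mem_le_weight; rewrite ln; lia.
Qed.

Lemma nth_mults n (l : {mset nat}) j : mset_weight l = n -> nth 0%N (mults n l) j = l j.+1.
Proof.
move=> ln; have [jn|nj] := ltnP j n; first by rewrite nth_mkseq.
rewrite nth_default ?size_mkseq //; apply/esym/eqP; rewrite mset_eq0.
by apply/negP => /mem_le_weight; rewrite ln; lia.
Qed.

(** Without a part 0, each occurrence adds at least 1 to the weight. *)
Lemma count_le_weight (l : {mset nat}) x : l 0%N = 0%N -> (l x <= mset_weight l)%N.
Proof.
move=> l0; rewrite -(count_mem_mset x l) -sum1_count /mset_weight big_mkcond /=.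
rewrite !big_seq; apply: leq_sum => y yl; case: eqP => // _.
by rewrite lt0n; apply/eqP => y0; move: yl; rewrite y0 -mset_neq0 l0.
Qed.

Definition gordon_list (k i n : nat) : seq {mset nat} :=
  [seq mset_of_mults s | s <- gordon_seqs k i n & weight 0 s == n].

Definition residue_list (k i n : nat) : seq {mset nat} :=
  [seq mset_of_mults s | s <- residue_seqs n k i 0 n & weight 0 s == n].

Lemma gordon_residue0 k i : gordon_residue k i 0.
Proof. by rewrite /gordon_residue mod0n inE. Qed.

Lemma mem_gordon_list k i n l : (0 < i)%N -> (i <= k)%N ->
  l \in gordon_list k i n <-> gordon_mset k i l /\ mset_weight l = n.
Proof.
move=> i0 ik; split.
  move=> /mapP[s]; rewrite mem_filter => /andP[/eqP sn].
  rewrite mem_gordon_seqs // => -[_ s0 sk] ->; rewrite mset_of_mults_weight.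
  split=> //; split; rewrite ?mset_of_multsE // => -[|j]; rewrite !mset_of_multsE //.
  by rewrite add0n; apply: leq_trans s0 ik.
move=> [[l0 l1 lk] ln]; apply/mapP; exists (mults n l); last by rewrite multsK.
rewrite mem_filter -mset_of_mults_weight multsK // ln eqxx /=.
rewrite mem_gordon_seqs // size_mkseq; split=> [//||j]; rewrite !nth_mults //.
Qed.

Lemma mem_residue_list k i n l :
  l \in residue_list k i n <-> residue_mset k i l /\ mset_weight l = n.
Proof.
split.
  move=> /mapP[s]; rewrite mem_filter => /andP[/eqP sn] /mem_residue_seqs[_ _ sr] ->.
  rewrite mset_of_mults_weight; split=> // -[|j] b; rewrite mset_of_multsE //.
  exact: sr.
move=> [lr ln]; have l0 := lr _ (gordon_residue0 k i).
apply/mapP; exists (mults n l); last by rewrite multsK.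
rewrite mem_filter -mset_of_mults_weight multsK // ln eqxx /=.
apply/mem_residue_seqs; rewrite size_mkseq; split=> // j.
  by rewrite nth_mults // -ln count_le_weight.
by rewrite nth_mults // => /lr.
Qed.

Lemma gordon_list_uniq k i n : (0 < i)%N -> (i <= k)%N -> uniq (gordon_list k i n).
Proof.
move=> i0 ik; rewrite map_inj_in_uniq ?filter_uniq ?gordon_seqs_uniq // => s t.
rewrite !mem_filter => /andP[_ /mem_gordon_seqs] /(_ i0 ik)[sn _ _].
by move=> /andP[_ /mem_gordon_seqs] /(_ i0 ik)[tn _ _]; apply: mset_of_mults_inj sn tn.
Qed.

Lemma residue_list_uniq k i n : uniq (residue_list k i n).
Proof.
rewrite map_inj_in_uniq ?filter_uniq ?residue_seqs_uniq // => s t.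
rewrite !mem_filter => /andP[_ /mem_residue_seqs[sn _ _]].
by move=> /andP[_ /mem_residue_seqs[tn _ _]]; apply: mset_of_mults_inj sn tn.
Qed.

Lemma size_gordon_residue_list k i n : (0 < i)%N -> (i <= k)%N ->
  size (gordon_list k i n) = size (residue_list k i n).
Proof. by move=> i0 ik; rewrite !size_map !size_filter count_gordon_residue. Qed.

(** Matches two lists of equal length by position; [x0] is never returned for an [x] in [r]. *)
Definition transfer (T : eqType) (x0 : T) (r s : seq T) (x : T) : T :=
  nth x0 s (index x r).

Lemma transfer_mem (T : eqType) (x0 : T) r s x :
  size r = size s -> x \in r -> transfer x0 r s x \in s.
Proof. by move=> rs xr; rewrite mem_nth // -rs index_mem. Qed.

Lemma transferK (T : eqType) (x0 : T) r s x :
  size r = size s -> uniq s -> x \in r -> transfer x0 s r (transfer x0 r s x) = x.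
Proof.
by move=> rs us xr; rewrite /transfer index_uniq ?nth_index // -rs index_mem.
Qed.

(** The bijection is not explicit: in each weight the two lists have the same length and are matched
    by position. *)
Lemma gordon_bijection k i : (0 < i)%N -> (i <= k)%N ->
  exists phi psi : {mset nat} -> {mset nat},
  (forall l, gordon_mset k i l -> [/\ residue_mset k i (phi l),
     mset_weight (phi l) = mset_weight l & psi (phi l) = l]) /\
  (forall l, residue_mset k i l -> [/\ gordon_mset k i (psi l),
     mset_weight (psi l) = mset_weight l & phi (psi l) = l]).
Proof.
move=> i0 ik; pose A := gordon_list k i; pose B := residue_list k i.
have AB n : size (A n) = size (B n) by apply: size_gordon_residue_list.
exists (fun l => transfer mset0 (A (mset_weight l)) (B (mset_weight l)) l).
exists (fun l => transfer mset0 (B (mset_weight l)) (A (mset_weight l)) l).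
split=> l lP.
  have lA : l \in A (mset_weight l) by apply/mem_gordon_list.
  have /mem_residue_list[fr fw] := transfer_mem mset0 (AB _) lA.
  by split=> //; rewrite fw transferK // residue_list_uniq.
have lB : l \in B (mset_weight l) by apply/mem_residue_list.
have /mem_gordon_list[//|//|fr fw] := transfer_mem mset0 (esym (AB _)) lB.
by split=> //; rewrite fw transferK // gordon_list_uniq.
Qed.

(** * Scales and primitive factors *)

(* Without an embedding every algebraic integer, even 0, would be vacuously totally
   positive. *)
Lemma exists_embedding (K : fieldExtType rat) : exists sigma : {rmorphism K -> algC}, True.
Proof.
have pcharK : [pchar K] =i pred0 := ftrans (pchar_lalg K) (pchar_num _).
(* K is generated by one element z; the embedding sends p(z) to p(r), where r is a complex root of
   the minimal polynomial of z. *)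
have sepK : separable 1 {:K} by apply/separableP => u _; apply: pcharf0_separable.
have Kz := eq_adjoin_separable_generator sepK (sub1v _).
set z := separable_generator _ _ in Kz.
have zP x : exists p : {poly rat}, x = (map_poly (in_alg K) p).[z].
  by apply/Fadjoin1_polyP; rewrite -Kz memvf.
have /polyOver1P[m mE] := minPolyOver 1 z.
have [r mr] : exists r : algC, root (map_poly ratr m) r.
  apply/closed_rootP; rewrite size_map_poly -(size_map_poly (in_alg K)) -mE size_minPoly.
  by rewrite eqSS.
pose f x := (map_poly ratr (sval (cid (zP x)))).[r] : algC.
(* Well-definedness: two polynomials with the same value at z differ by a multiple of the minimal
   polynomial. *)
have fE p : f (map_poly (in_alg K) p).[z] = (map_poly ratr p).[r].
  rewrite /f; case: cid => q /= pq; apply/eqP; rewrite -subr_eq0 -hornerN -hornerD -rmorphB.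
  have : map_poly (in_alg K) m %| map_poly (in_alg K) (q - p).
    rewrite -mE; apply: minPoly_dvdp; first by apply/polyOver1P; exists (q - p).
    by rewrite rmorphB /root hornerD hornerN -pq subrr.
  rewrite dvdp_map => /dvdpP[u ->]; rewrite rmorphM hornerM.
  by move/rootP: mr => ->; rewrite mulr0.
have fB : zmod_morphism f.
  move=> x y; have [p ->] := zP x; have [q ->] := zP y.
  by rewrite -hornerN -hornerD -rmorphB !fE rmorphB hornerD hornerN.
have fM : monoid_morphism f.
  split=> [|x y].
    by have := fE 1; rewrite !rmorph1 !hornerC.
  have [p ->] := zP x; have [q ->] := zP y.
  by rewrite -hornerM -rmorphM !fE rmorphM hornerM.
pose fBM := GRing.isZmodMorphism.Build K algC f fB.
pose fMM := GRing.isMonoidMorphism.Build K algC f fM.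
pose g : {rmorphism K -> algC} := HB.pack f fBM fMM.
by exists g.
Qed.

Section ScaleAndPrimitiveFactor.

Variable K : fieldExtType rat.
Implicit Types (x y g d : K).

Lemma Oplus_neq0 x : Oplus x -> x != 0.
Proof.
have [sigma _] := exists_embedding K.
by move=> [_ /(_ sigma)]; apply: contraTneq => ->; rewrite rmorph0 ltxx.
Qed.

Lemma Oplus_mulrn x n : (0 < n)%N -> Oplus x -> Oplus (x *+ n).
Proof.
move=> n0 [xi xp]; split; last by move=> sigma; rewrite rmorphMn pmulrn_lgt0.
by rewrite /algebraic_integer -mulr_natr; apply: integral_mul => //; apply: integral_nat.
Qed.

Lemma mulrn_injl n : (0 < n)%N -> injective (fun x => x *+ n).
Proof.
have [sigma _] := exists_embedding K.
move=> n0 x y /(congr1 sigma); rewrite !rmorphMn => /(pmulrnI n0).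
exact: fmorph_inj.
Qed.

Lemma mulrn_injr x : x != 0 -> injective (fun n : nat => x *+ n).
Proof.
have [sigma _] := exists_embedding K.
move=> x0 m n /(congr1 sigma); rewrite !rmorphMn => /(mulrIn _); apply.
by rewrite fmorph_eq0.
Qed.

(* [m] is, up to sign, the lowest nonzero coefficient of a polynomial killing [x]. *)
Lemma integral_cofactor x : algebraic_integer x -> x != 0 ->
  exists c, exists2 m : int, m != 0 & algebraic_integer c /\ c * x = m%:~R.
Proof.
move=> xi x0.
have main (p : {poly int}) : p != 0 -> root (map_poly intr p) x ->
    exists c, exists2 m : int, m != 0 & algebraic_integer c /\ c * x = m%:~R.
  elim/poly_ind: p => [|p c IH]; first by rewrite eqxx.
  rewrite /root rmorphD rmorphM /= map_polyX map_polyC hornerMXaddC -[X in _ * x + X]/(c%:~R : K).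
  have [-> |c0] := eqVneq c 0.
    rewrite polyC0 addr0 mulr0z addr0 [_ * x == 0]mulf_eq0 (negPf x0) orbF => pX px; apply: IH => //.
    by apply: contraNneq pX => ->; rewrite mul0r.
  move=> _ pxc; exists (map_poly intr p).[x], (- c); first by rewrite oppr_eq0.
  split; last by move: pxc; rewrite addr_eq0 mulrNz => /eqP.
  apply: integral_horner => //; apply/integral_poly => j; rewrite coef_map.
  exact: integral_id.
by have [p /monic_neq0 p0 px] := xi; apply: main px.
Qed.

(* If [x = y *+ n] and [c * x = m], then [c * y = m / n] is a rational algebraic
   integer, hence [n] divides [m]. *)
Lemma divisor_bound x : algebraic_integer x -> x != 0 ->
  exists m : nat, forall n y, algebraic_integer y -> x = y *+ n -> (n <= m)%N.
Proof.
move=> xi x0; have [c [m m0 [ci cx]]] := integral_cofactor xi x0.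
exists `|m|%N => n y yi xy.
have [sigma _] := exists_embedding K.
have n0 : (n%:R != 0 :> algC).
  by apply: contraNneq x0 => /eqP; rewrite pnatr_eq0 => /eqP n0; rewrite xy n0 mulr0n.
have cyn : sigma (c * y) = m%:~R / n%:R.
  apply: (canRL (mulfK n0)); rewrite -(rmorph_nat sigma n) -rmorphM -mulrA mulr_natr -xy cx.
  by rewrite rmorph_int.
have : sigma (c * y) \in Aint.
  have [p pm pr] : integralOver (intr : int -> K) (c * y) by apply: integral_mul.
  apply: (@root_monic_Aint (map_poly intr p)); last first.
  - by apply/polyOverP => j; rewrite coef_map rpred_int.
  - exact: monic_map.
  - have -> : map_poly intr p = map_poly sigma (map_poly intr p) :> {poly algC}.
      by rewrite -map_poly_comp; apply: eq_map_poly => a /=; rewrite rmorph_int.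
    by rewrite fmorph_root.
move=> /(Cint_rat_Aint _)/[!cyn] H.
have : m%:~R / n%:R \is a (@Num.int algC).
  by apply: H; rewrite rpred_div ?rpred_int ?rpred_nat.
move=> /intrP[a aE].
have mE : m = a * n%:Z.
  apply: (@intr_inj algC); rewrite rmorphM /= -aE -[n%:Z%:~R]/(n%:R : algC) divfK //.
have a0 : a != 0 by apply: contraNneq m0 => a0; rewrite mE a0 mul0r.
by rewrite mE abszM /= leq_pmull // absz_gt0.
Qed.

(** The largest n such that d is n times an element of [Oplus] exists by [divisor_bound]; a further
    divisor p >= 2 of the cofactor would make p n admissible. *)
Lemma exists_primitive_factor d : Oplus d ->
  exists n g, [/\ (0 < n)%N, primitive g & d = g *+ n].
Proof.
move=> dO; have [m mP] := divisor_bound dO.1 (Oplus_neq0 dO).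
pose P n := `[< exists2 g, Oplus g & d = g *+ n >].
have exP : exists n, P n by exists 1%N; apply/asboolP; exists d.
have ubP n : P n -> (n <= m)%N by move=> /asboolP[g [gi _]]; apply: mP.
case: (ex_maxnP exP ubP) => n /asboolP[g gO dE] nmax.
have n0 : (0 < n)%N.
  by rewrite lt0n; apply: contraTneq (Oplus_neq0 dO) => n0; rewrite dE n0 mulr0n eqxx.
exists n, g; split=> //; split=> // p p2 [b bO bE].
have /nmax : P (p * n)%N by apply/asboolP; exists b; rewrite // dE -bE mulrnA.
by nia.
Qed.

(** By Bezout, u a = v b + 1, and y = u h - v g satisfies b y = g. Thus y is integral and, like g,
    totally positive, so primitivity of g forces b = 1. *)
Lemma coprime_primitive g h a b : (0 < b)%N -> coprime a b ->
  primitive g -> Oplus h -> g *+ a = h *+ b -> b = 1%N.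
Proof.
move=> b0 cab [gO gP] [hi _] gh.
have [a0|a0] := posnP a.
  by move: cab; rewrite a0 /coprime gcd0n => /eqP.
case: (egcdnP b a0) => u v; rewrite (eqP cab) => uE _.
pose y := h *+ u - g *+ v.
have yE : y *+ b = g.
  rewrite mulrnBl -!mulrnA [(u * b)%N]mulnC mulrnA -gh -mulrnA [(a * _)%N]mulnC uE.
  by rewrite mulrnDr addrC addKr.
apply/eqP; rewrite eqn_leq b0 andbT leqNgt; apply/negP => b2.
apply: (gP b b2); exists y => //; split.
  apply: integral_sub; rewrite -mulr_natr; apply: integral_mul => //;
    by [apply: integral_nat | apply: gO.1].
by move=> sigma; have := gO.2 sigma; rewrite -yE rmorphMn pmulrn_lgt0.
Qed.

Lemma primitive_factor_unique n m g h : (0 < n)%N -> (0 < m)%N ->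
  primitive g -> primitive h -> g *+ n = h *+ m -> n = m /\ g = h.
Proof.
move=> n0 m0 gP hP gh; pose c := gcdn n m.
have c0 : (0 < c)%N by rewrite gcdn_gt0 n0.
have [nE mE] : n = (n %/ c * c)%N /\ m = (m %/ c * c)%N.
  by rewrite !divnK ?dvdn_gcdl ?dvdn_gcdr.
have cop : coprime (n %/ c) (m %/ c).
  by rewrite /coprime -(eqn_pmul2r c0) muln_gcdl -nE -mE mul1n.
have gh' : g *+ (n %/ c) = h *+ (m %/ c).
  by apply: (mulrn_injl c0); rewrite -!mulrnA -nE -mE.
have n1 : (0 < n %/ c)%N by rewrite divn_gt0 // dvdn_leq // dvdn_gcdl.
have m1 : (0 < m %/ c)%N by rewrite divn_gt0 // dvdn_leq // dvdn_gcdr.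
have mc := coprime_primitive m1 cop gP hP.1 gh'.
rewrite coprime_sym in cop.
have nc := coprime_primitive n1 cop hP gP.1 (esym gh').
by split; [rewrite nE mE mc nc | move: gh'; rewrite mc nc].
Qed.

Lemma scale_primitive_factorP d : Oplus d ->
  [/\ (0 < scale d)%N, primitive (primitive_factor d) &
      d = primitive_factor d *+ scale d].
Proof.
move=> dO; have [n [g gP]] := exists_primitive_factor dO.
rewrite /scale /primitive_factor /scale_primitive_factor.
by case: xgetP => [[s t] -> //|/(_ (n, g))].
Qed.

Lemma scale_primitiveE n g : (0 < n)%N -> primitive g ->
  scale (g *+ n) = n /\ primitive_factor (g *+ n) = g.
Proof.
move=> n0 gP; have [s0 tP E] := scale_primitive_factorP (Oplus_mulrn n0 gP.1).
by have [nE gE] := primitive_factor_unique n0 s0 gP tP E; split.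
Qed.

End ScaleAndPrimitiveFactor.

(** * Decomposition of partitions by primitive factor *)

Lemma gordon_residue_int k i n : (i <= k)%N ->
  ~~ gordon_residue k i n <->
  [/\ (n%:Z != 0 %[mod (2 * k + 1)%N%:Z])%Z,
      (n%:Z != i%:Z %[mod (2 * k + 1)%N%:Z])%Z
    & (n%:Z != - i%:Z %[mod (2 * k + 1)%N%:Z])%Z].
Proof.
move=> ik; set c := (2 * k + 1)%N.
have -> : (- i%:Z = -1 * c%:Z + (c - i)%N%:Z)%R by rewrite -subzn /c; lia.
rewrite modzMDl mod0z !modz_nat (modn_small (_ : i < c)%N); last by rewrite /c; lia.
(* For i = 0 the representative c - i = c is not reduced. *)
have -> : (((c - i) %% c)%N%:Z = (if i == 0%N then 0%N else (c - i)%N)%:Z)%R.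
  by case: eqP => [->|?]; rewrite ?subn0 ?modnn // modn_small //; lia.
rewrite /gordon_residue -/c !inE !negb_or !eqz_nat; split.
  by move=> /and3P[a b d]; split=> //; case: ifP.
move=> [-> -> d] /=; move: d; have [-> _|//] := eqVneq i 0%N.
by rewrite subn0 neq_ltn ltn_pmod // /c addn1.
Qed.

Section PartitionsByPrimitiveFactor.

Variable K : fieldExtType rat.
Implicit Types (x y g d : K) (l : {mset K}) (phi : {mset nat} -> {mset nat}).

Definition Oplus_parts l : Prop := forall x, x \in l -> Oplus x.

Definition component l g : {mset nat} :=
  seq_mset [seq scale x | x <- l & primitive_factor x == g].

Lemma componentE l g n : Oplus_parts l -> primitive g ->
  component l g n = if (0 < n)%N then l (g *+ n) else 0%N.
Proof.
move=> lO gP; rewrite mset_seqE count_map count_filter.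
have [->|n0] := posnP n.
  apply/eqP; rewrite -leqn0 leqNgt -has_count; apply/hasPn => x /lO xO /=.
  by have [s0 _ _] := scale_primitive_factorP xO; rewrite negb_and -lt0n s0.
rewrite /= -[RHS]count_mem_mset; apply: eq_in_count => x /lO xO /=.
have [_ _ xE] := scale_primitive_factorP xO.
have [sE tE] := scale_primitiveE n0 gP.
apply/andP/eqP => [[/eqP sx /eqP tx]|->]; first by rewrite xE sx tx.
by rewrite sE tE !eqxx.
Qed.

Lemma component0 l g : Oplus_parts l -> primitive g -> component l g 0%N = 0%N.
Proof. by move=> lO gP; rewrite componentE. Qed.

Lemma componentP l x : Oplus_parts l -> Oplus x ->
  l x = component l (primitive_factor x) (scale x).
Proof.
move=> lO xO; have [s0 tP xE] := scale_primitive_factorP xO.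
by rewrite componentE // s0 -xE.
Qed.

Lemma component_inj l l' : Oplus_parts l -> Oplus_parts l' ->
  (forall g, primitive g -> component l g = component l' g) -> l = l'.
Proof.
move=> lO lO' E; apply/msetP => x.
have [xO|xO] := asboolP (Oplus x).
  by rewrite !componentP // E //; have [] := scale_primitive_factorP xO.
have out (r : {mset K}) : Oplus_parts r -> r x = 0%N.
  by move=> rO; apply/eqP; rewrite mset_eq0; apply/negP => /rO.
by rewrite !out.
Qed.

Definition primitive_factors l : seq K := undup [seq primitive_factor x | x <- l].

(** Acts by [phi] on each component and multiplies back. Only primitive factors occurring in [l] are
    visited, so [phi] has to fix [mset0] for the other components to agree. *)
Definition lift_mset phi l : {mset K} :=
  seq_mset (flatten [seq [seq g *+ n | n <- phi (component l g)]
                    | g <- primitive_factors l]).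

Lemma primitive_factorsP l g : Oplus_parts l -> g \in primitive_factors l -> primitive g.
Proof.
move=> lO; rewrite mem_undup => /mapP[x /lO xO ->].
by have [] := scale_primitive_factorP xO.
Qed.

Lemma component_notin l g : g \notin primitive_factors l -> component l g = mset0.
Proof.
rewrite mem_undup => gl; apply/msetP => n; rewrite mset0E mset_seqE count_map count_filter.
apply/eqP; rewrite -leqn0 leqNgt -has_count; apply/hasPn => x xl /=.
by rewrite negb_and orbC; apply/orP; left; apply: contraNneq gl => <-; apply: map_f.
Qed.

Section Lift.

Variables (phi : {mset nat} -> {mset nat}) (l : {mset K}).
Hypothesis l_Oplus : Oplus_parts l.
Hypothesis phi0 : forall g, primitive g -> phi (component l g) 0%N = 0%N.

Lemma lift_mset_Oplus : Oplus_parts (lift_mset phi l).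
Proof.
move=> x; rewrite (perm_mem (perm_eq_seq_mset _)) => /flatten_mapP[g gl /mapP[n np ->]].
have gP := primitive_factorsP l_Oplus gl; apply: Oplus_mulrn; last exact: gP.1.
by rewrite lt0n; apply: contraTneq np => ->; rewrite -mset_eq0 phi0.
Qed.

(** By uniqueness of the primitive factor, a positive multiple of h is a multiple of g only for h =
    g, so a single block contributes. *)
Lemma component_lift_mset g : phi mset0 = mset0 -> primitive g ->
  component (lift_mset phi l) g = phi (component l g).
Proof.
move=> phi00 gP; apply/msetP => n; rewrite componentE //; last exact: lift_mset_Oplus.
case: posnP => [->|n0]; first by rewrite phi0.
rewrite mset_seqE count_flatten -map_comp sumnE big_map.
have term h : h \in primitive_factors l ->
    count_mem (g *+ n) [seq h *+ m | m <- phi (component l h)] =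
    if h == g then phi (component l g) n else 0%N.
  move=> /(primitive_factorsP l_Oplus) hP; rewrite count_map.
  case: eqVneq => [->|hg].
    rewrite -[RHS]count_mem_mset; apply: eq_in_count => m mp /=.
    by rewrite (inj_eq (mulrn_injr (Oplus_neq0 gP.1))).
  apply/eqP; rewrite -leqn0 leqNgt -has_count; apply/hasPn => m mp /=.
  apply: contra_neqN hg => /eqP E.
  have m0 : (0 < m)%N by rewrite lt0n; apply: contraTneq mp => ->; rewrite -mset_eq0 phi0.
  by have [] := primitive_factor_unique m0 n0 hP gP E.
rewrite (eq_big_seq _ term) -big_mkcond /=.
have [gl|gl] := boolP (g \in primitive_factors l).
  by rewrite -big_filter filter_pred1_uniq ?undup_uniq // big_seq1.
rewrite component_notin // phi00 mset0E big_seq_cond big_pred0 // => h.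
by apply/negP => /andP[hl /eqP hg]; rewrite -hg hl in gl.
Qed.

Lemma sum_lift_mset :
  \sum_(x <- lift_mset phi l) x =
  \sum_(g <- primitive_factors l) g *+ mset_weight (phi (component l g)).
Proof.
rewrite (perm_big _ (perm_eq_seq_mset _)) big_flatten big_map; apply: eq_bigr => g _.
by rewrite big_map sumrMnr.
Qed.

End Lift.

(** Lifting the identity regroups [l] by primitive factor, which serves to compute its sum. *)
Lemma lift_mset_id l : Oplus_parts l -> lift_mset id l = l.
Proof.
move=> lO; have c0 g : primitive g -> id (component l g) 0%N = 0%N by apply: component0.
apply: component_inj => // [|g gP]; first exact: lift_mset_Oplus.
by rewrite component_lift_mset.
Qed.

Lemma sum_components l : Oplus_parts l ->
  \sum_(x <- l) x = \sum_(g <- primitive_factors l) g *+ mset_weight (component l g).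
Proof. by move=> lO; rewrite -{1}(lift_mset_id lO) sum_lift_mset. Qed.

(** The parts counted at x have scale s(x) or s(x) - 1, so the count is a sum of two neighbouring
    multiplicities in one component. *)
Lemma gordon_components k i l : (0 < i)%N -> (i <= k)%N -> Oplus_parts l ->
  gordon_difference_condition k l /\ gordon_primitive_condition i l <->
  forall g, primitive g -> gordon_mset k i (component l g).
Proof.
move=> i0 ik lO.
have countE x : x \in l ->
    count (fun y => (primitive_factor y == primitive_factor x) &&
                    ((scale x)%:Z - (scale y)%:Z \in [:: 0; 1])%R) l =
    (component l (primitive_factor x) (scale x)
     + component l (primitive_factor x) (scale x).-1)%N.
  move=> /lO xO; have [s0 _ _] := scale_primitive_factorP xO.
  rewrite !mset_seqE !count_map !count_filter -count_predUI.
  rewrite [X in (_ + X)%N](eq_count (a2 := pred0)) ?count_pred0 ?addn0; last first.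
    by move=> y /=; apply/negP => /andP[/andP[/eqP a _] /andP[/eqP b _]]; lia.
  by apply: eq_count => y /=; rewrite !inE; case: (_ == _) => /=; rewrite ?andbF ?andbT //; lia.
have primE g : primitive g -> count (fun y => y == g) l = component l g 1%N.
  by move=> gP; rewrite componentE // mulr1n -count_mem_mset.
split=> [[dif prim] g gP | G].
  have c0 := component0 lO gP.
  have step n : component l g n != 0%N -> (component l g n + component l g n.-1 < k)%N.
    move=> cn; have n0 : (0 < n)%N by rewrite lt0n; apply: contraNneq cn => ->; rewrite c0.
    have [sE tE] := scale_primitiveE n0 gP.
    have gl : g *+ n \in l by rewrite -mset_neq0; move: cn; rewrite componentE // n0.
    by have := dif _ gl; rewrite countE // sE tE; lia.
  split=> // [|x]; first by have := prim g gP; rewrite primE //; lia.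
  (* The difference condition speaks only of parts that occur: if x+1 is absent the bound at x
     applies, and if both are absent the sum is 0 < k. *)
  have [c1|/step] := eqVneq (component l g x.+1) 0%N; last by rewrite addnC.
  by rewrite c1 addn0; have [->|/step] := eqVneq (component l g x) 0%N; lia.
split=> [x xl|g gP].
  have [s0 tP _] := scale_primitive_factorP (lO _ xl).
  have [_ _ /(_ (scale x).-1)] := G _ tP; rewrite countE // prednK // addnC; lia.
by have [_ + _] := G _ gP; rewrite primE //; lia.
Qed.

Lemma residue_components k i l : (i <= k)%N -> Oplus_parts l ->
  gordon_congruence_condition k i l <->
  forall g, primitive g -> residue_mset k i (component l g).
Proof.
move=> ik lO; split=> [cong g gP n nr | R x xl].
  rewrite componentE //; case: posnP => // n0; apply/eqP; rewrite mset_eq0.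
  apply/negP => /cong; have [-> _] := scale_primitiveE n0 gP.
  by rewrite -gordon_residue_int // nr.
rewrite -gordon_residue_int //; apply/negP => xr.
have xO := lO _ xl; have [_ tP _] := scale_primitive_factorP xO.
by move: xl; rewrite -mset_neq0 componentP // R.
Qed.

(** Stated for abstract classes [P] and [Q] so that it serves both directions of the bijection. *)
Lemma lift_msetK phi psi l (P Q : {mset nat} -> Prop) :
  (forall m, P m -> [/\ Q (phi m), mset_weight (phi m) = mset_weight m & psi (phi m) = m]) ->
  (forall m, P m -> m 0%N = 0%N) -> (forall m, Q m -> m 0%N = 0%N) -> P mset0 ->
  Oplus_parts l -> (forall g, primitive g -> P (component l g)) ->
  [/\ Oplus_parts (lift_mset phi l),
      forall g, primitive g -> Q (component (lift_mset phi l) g),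
      \sum_(x <- lift_mset phi l) x = \sum_(x <- l) x
    & lift_mset psi (lift_mset phi l) = l].
Proof.
move=> phiP P0 Q0 Pn lO lP.
have phi0 g : primitive g -> phi (component l g) 0%N = 0%N.
  by move=> /lP/phiP[/Q0].
have phi00 : phi mset0 = mset0.
  (* The image of [mset0] has weight 0 and no part 0, hence is empty. *)
  have [/Q0 z w _] := phiP _ Pn; apply/msetP => n; rewrite mset0E.
  by apply/eqP; rewrite -leqn0; apply: leq_trans (count_le_weight n z) _;
     rewrite w /mset_weight big_mset0.
have lO' := lift_mset_Oplus lO phi0.
have comp g : primitive g -> component (lift_mset phi l) g = phi (component l g).
  exact: component_lift_mset.
have psi0 g : primitive g -> psi (component (lift_mset phi l) g) 0%N = 0%N.
  by move=> gP; rewrite comp //; have [_ _ ->] := phiP _ (lP _ gP); apply: component0.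
split=> //.
- by move=> g gP; rewrite comp //; have [] := phiP _ (lP _ gP).
- rewrite sum_lift_mset (sum_components lO) !big_seq; apply: eq_bigr => g gl.
  by have [_ -> _] := phiP _ (lP _ (primitive_factorsP lO gl)).
apply: component_inj => // [|g gP]; first exact: lift_mset_Oplus.
rewrite component_lift_mset //; first by rewrite comp //; have [] := phiP _ (lP _ gP).
by have [_ _] := phiP _ Pn; rewrite phi00.
Qed.

End PartitionsByPrimitiveFactor.

(** * Equinumerosity of the two classes of partitions *)

Unset Implicit Arguments.
Local Open Scope classical_set_scope.
Local Open Scope card_scope.

Theorem theorem3p8 (K : fieldExtType rat) (K_totally_real : totally_real K)
    (k i : nat) (k_ge2 : (2 <= k)%N) (i_ge1 : (1 <= i)%N) (i_lek : (i <= k)%N)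
    (delta : K) (delta_Oplus : Oplus delta) :
  [set l : {mset K} | [/\ is_partition delta l,
                          gordon_difference_condition k l
                        & gordon_primitive_condition i l]]
  #= [set l : {mset K} | is_partition delta l /\
                         gordon_congruence_condition k i l].
Proof.
have [phi [psi [phiP psiP]]] := gordon_bijection i_ge1 i_lek.
have G0 m : gordon_mset k i m -> m 0%N = 0%N by case.
have R0 m : residue_mset k i m -> m 0%N = 0%N by apply; apply: gordon_residue0.
have Gn : gordon_mset k i mset0 by split=> [||x]; rewrite !mset0E //; apply: ltnW.
have Rn : residue_mset k i mset0 by move=> x _; rewrite mset0E.
set A := [set l | _]; set B := [set l | _].
have AB l : A l -> B (lift_mset phi l) /\ lift_mset psi (lift_mset phi l) = l.
  move=> [[lO lS] dif prim]; have lG := (gordon_components i_ge1 i_lek lO).1 (conj dif prim).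
  have [rO rR rS rK] := lift_msetK phiP G0 R0 Gn lO lG.
  by split=> //; split; [split=> //; rewrite rS | apply/residue_components].
have BA l : B l -> A (lift_mset psi l) /\ lift_mset phi (lift_mset psi l) = l.
  move=> [[lO lS] /(residue_components i_lek lO) lR].
  have [rO rG rS rK] := lift_msetK psiP R0 G0 Rn lO lR.
  have [dif prim] := (gordon_components i_ge1 i_lek rO).2 rG.
  by split=> //; split=> //; split=> //; rewrite rS.
(* The second class is the image of the first under a map with a left inverse there. *)
have -> : B = lift_mset phi @` A.
  apply/seteqP; split=> [l /BA[lA lK]|_ [l /AB[lB _] <-] //].
  by exists (lift_mset psi l).
apply: card_esym; apply: inj_card_eq => l l' /set_mem/AB[_ lK] /set_mem/AB[_ lK'] E.
by rewrite -lK E lK'.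
Qed.
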